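(* Let $(G_t)_{t\geq 0}$ be a growing process with growth rate $r>0$ (and renewal rate $\lambda>0$). Suppose the sequence of consecutive haircuts $(\ell,s+ni)_{n\in\mathbb{N}_0}$, with $\ell,s\geq 0$, $rs\geq \ell$ and period $i>0$, acts on the growing process to induce the haircut process $(H_t)_{t\geq 0}$. Then for $n\in\mathbb{N}$ the local law between the $n$th and $(n+1)$th haircuts is given by $$(H_t)_{t\in[s+ni,\,s+(n+1)i)}\sim (G_t)_{t\in[\frac{\ell}{r},\,\frac{\ell}{r}+i)},$$ that is, the processes $(H_{s+ni+u})_{u\in[0,i)}$ and $(G_{\frac{\ell}{r}+u})_{u\in[0,i)}$ have the same law.
   Context: $\mathbb{N}=\{1,2,\dots\}$ and $\mathbb{N}_0=\mathbb{N}\cup\{0\}$; $\sim$ denotes equality in law (of stochastic processes). Timing process: for positive i.i.d. random variables $(X_j)_{j\in\mathbb{N}}$ put $Y_n=\sum_{j=1}^n X_j$ for $n\in\mathbb{N}_0$ (so $Y_0=0$), and $Z_t=\inf\{t-Y_n : n\in\mathbb{N}_0,\ t-Y_n\geq 0\}$ for $t\geq 0$. Then $(Z_t)_{t\geq 0}$ is the timing process induced by inter-renewal time $X$ (the common law of the $X_j$). For $\alpha\ge 0$ not an upper bound on the range of $X$, the timing process started at $\alpha$ is $Z_t^{\alpha}=Z_{\tau_\alpha+t}$, where $\tau_\alpha=\inf\{t\geq 0: Z_t=\alpha\}$. Growing process: given $\lambda>0$, $r>0$, let $(Z_t)_{t\geq 0}$ be a timing process with $\exp(\lambda)$ inter-renewal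 times (rate $\lambda$, mean $1/\lambda$). Then $G_t=rZ_t$ defines a growing process with growth rate $r$ and renewal rate $\lambda$. The growing process started at $\alpha\geq 0$ is $G_t^{\alpha}=rZ_t^{\alpha/r}$, so $G_0^\alpha=\alpha$. Haircuts: a haircut is a pair $(\ell,s)$ with cutoff length $\ell\geq 0$ and haircut time $s\geq 0$. It acts on a growing process $(G_t)_{t\geq 0}$ to give the process $((\ell,s).G_t)_{t\geq 0}$ with $$(\ell,s).G_t=\begin{cases} G_t & t<s,\\ G_{t-s}^{\min\{G_s,\ell\}} & t\geq s.\end{cases}$$ Here, for a random starting point, $(G_u^{\min\{G_s,\ell\}})_{u\ge 0}$ is understood as follows: conditionally on $(G_t)_{t\le s}$ with $\min\{G_s,\ell\}=a$, it is distributed as a growing process with the same rates $r,\lambda$ started at $a$; in particular $(\ell,s).G_s=\min\{G_s,\ell\}$. A sequence of haircuts acts on a growing process by inductively applying this formulation: each successive haircut at time $s'$ leaves the current process unchanged before time $s'$ and, from time $s'$ on, replaces it by a growing process (same $r,\lambda$) started at the minimum of its current value at time $s'$ and the cutoff length, in the same conditional sense. The resulting process is called a haircut process. *)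

(* Defs.v *)
From mathcomp Require Import all_boot all_order all_algebra.
From mathcomp Require Import all_classical all_reals all_analysis.

Set Implicit Arguments.
Unset Strict Implicit.
Unset Printing Implicit Defensive.

Import Order.TTheory GRing.Theory Num.Theory.

Local Open Scope classical_set_scope.
Local Open Scope ring_scope.

(* A stochastic process on [T] is a function [Z : R -> T -> R], [Z t w] being
   its value at time [t]; only the values at times [t >= 0] are meaningful. *)

Section laws.
Context {R : realType}.

(* For a set [D] of times, the sigma-algebra on [U] generated by the maps
   [Z t], t in D. *)
Definition generated_by {U : Type} (D : set R) (Z : R -> U -> R) :
    set_system U :=
  <<s \bigcup_(t in D) preimage_set_system setT (Z t) measurable >>.

(* The cylinder sigma-algebra of R^D, carried by the total functions R -> R:
   its members only depend on the restriction of a path to D. *)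
Definition cylinders (D : set R) : set_system (R -> R) :=
  generated_by D (fun t (f : R -> R) => f t).

Definition path_law d (T : measurableType d) (P : probability T R)
    (Z : R -> T -> R) (B : set (R -> R)) : \bar R :=
  P [set w | B (fun t => Z t w)].

(* (Z_t)_{t in D} ~ (Z'_t)_{t in D} *)
Definition eq_law d (T : measurableType d) (P : probability T R)
    d' (T' : measurableType d') (P' : probability T' R)
    (D : set R) (Z : R -> T -> R) (Z' : R -> T' -> R) : Prop :=
  forall B, cylinders D B -> path_law P Z B = path_law P' Z' B.

End laws.

Section growing.
Context {R : realType} d (T : measurableType d) (P : probability T R).

(* The inter-renewal times X_1, X_2, ... are indexed from 0: X_{j+1} is
   [X j]. *)

Definition mutually_independent (X : nat -> {RV P >-> R}) : Prop :=
  forall (J : seq nat) (B : nat -> set R), uniq J ->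
    (forall j, measurable (B j)) ->
    P (\bigcap_(j in [set` J]) (X j @^-1` B j)) =
      (\prod_(j <- J) P (X j @^-1` B j))%E.

(* Equality of laws is only required on measurable sets: both sides are total
   functions of an arbitrary set of reals. *)
Definition iid_exponential (lambda : R) (X : nat -> {RV P >-> R}) : Prop :=
  [/\ forall j w, 0 < X j w,
      mutually_independent X &
      forall j B, measurable B ->
        distribution P (X j) B = exponential_prob lambda B].

Definition renewal_time (X : nat -> {RV P >-> R}) (n : nat) (w : T) : R :=
  \sum_(j < n) X j w.

Definition timing (X : nat -> {RV P >-> R}) (t : R) (w : T) : R :=
  inf [set z | exists n, z = t - renewal_time X n w /\ 0 <= z].

Definition hitting_time (X : nat -> {RV P >-> R}) (a : R) (w : T) : R :=
  inf [set t | 0 <= t /\ timing X t w = a].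

Definition timing_from (X : nat -> {RV P >-> R}) (a t : R) (w : T) : R :=
  timing X (hitting_time X a w + t) w.

Definition growing (r : R) (X : nat -> {RV P >-> R}) (t : R) (w : T) : R :=
  r * timing X t w.

Definition growing_from (r : R) (X : nat -> {RV P >-> R}) (a t : R) (w : T) :
    R :=
  r * timing_from X (a / r) t w.

(* [acts r X (l, s) G G'] : the process [G'] is the result of the haircut
   (l, s) acting on [G].  The conditional law of (G'_{s+u})_{u >= 0} given
   sigma(G_t, 0 <= t <= s) is that of the growing process started at
   min(G_s, l), i.e. the kernel a |-> law of [growing_from r X a] evaluated at
   a = min(G_s, l). *)
Definition acts (r : R) (X : nat -> {RV P >-> R}) (h : R * R)
    (G G' : R -> T -> R) : Prop :=
  let: (l, s) := h in
  (forall t, 0 <= t < s -> G' t = G t) /\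
  (forall A B, generated_by `[0, s] G A -> cylinders `[0, +oo[ B ->
     P (A `&` [set w | B (fun u => G' (s + u) w)]) =
     (\int[P]_(w in A)
        path_law P (growing_from r X (Num.min (G s w) l)) B)%E).

(* [Hs k] is the process after the first k haircuts.  When the haircut times
   tend to infinity, [Hs k t] is eventually constant in k, and its eventual
   value is the haircut process at time t. *)
Definition haircut_process (r : R) (X : nat -> {RV P >-> R})
    (h : nat -> R * R) (H : R -> T -> R) : Prop :=
  exists Hs : nat -> R -> T -> R,
    [/\ forall k t, 0 <= t -> measurable_fun setT (Hs k t),
        forall t, 0 <= t -> Hs 0%N t = growing r X t,
        forall k, acts r X (h k) (Hs k) (Hs k.+1) &
        forall t, 0 <= t -> \forall k \near \oo, H t = Hs k t].

End growing.

(* Main.v *)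
Require Import Defs.
From HB Require Import structures.
From mathcomp Require Import all_boot all_order all_algebra.
From mathcomp Require Import all_classical all_reals all_analysis.
From mathcomp Require Import measurable_realfun.
From mathcomp Require Import ring lra.

(* Let [Z] be the age process of the renewal sequence [X], and call overshoot
   of a threshold process [V] the sequence formed by the excess over [V] of the
   first gap exceeding it, followed by the later gaps.  Since exponential gaps
   are memoryless, the overshoot of a threshold that only depends on the past is
   independent of the threshold and distributed as [X].
   - The constant threshold [a] shows that the process started at [a] has the
     law of the age process with initial age [a] and gaps [X].
   - The threshold [b - (last renewal before b)] gives the Markov property at
     time [b]: [Z_(b+u)] is the age process with initial age [Z_b] and an
     independent sequence of gaps.
   By the latter, [P (x <= Z_t)] is the probability that a gap exceeds [x], for
   every [t >= x]; hence the law of [min (G_t, l)] does not depend on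
   [t >= l / r] and is that of [G_(l/r)].  So if the value just after a haircut
   has the law of [G_(l/r)], the process from then on has the law of
   [G_(l/r+u)], and its value after the next haircut has the law of
   [min (G_(l/r+i), l)], again that of [G_(l/r)]. *)

Set Implicit Arguments.
Unset Strict Implicit.
Unset Printing Implicit Defensive.

Import Order.TTheory GRing.Theory Num.Theory.
Import numFieldNormedType.Exports.

Local Open Scope classical_set_scope.
Local Open Scope ring_scope.

(** * Age of a deterministic renewal sequence *)

Section renewal_sequences.
Context {R : realType}.
Implicit Types (x : nat -> R) (a b t u : R) (m n : nat).

Definition renewal x n : R := \sum_(j < n) x j.

(** Pathwise form of [timing]: [timing X t w] is convertible to [age (gaps X w) t], so path
    identities can be proved for one fixed sequence. *)
Definition age x t : R := inf [set z | exists n, z = t - renewal x n /\ 0 <= z].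

Definition shift_seq n x : nat -> R := fun j => x (n + j)%N.

Definition prepend a x : nat -> R := fun j => if j is k.+1 then x k else a.

(** For positive [x], the age process with age [a] at time 0, where [x 0] is the residual time
    before the first renewal; the offset [a] is lost at that renewal. *)
Definition age_from a x u : R := age x u + (if u < x 0%N then a else 0).

Lemma renewal0 x : renewal x 0 = 0.
Proof. by rewrite /renewal big_ord0. Qed.

Lemma renewalS x n : renewal x n.+1 = renewal x n + x n.
Proof. by rewrite /renewal big_ord_recr. Qed.

Lemma renewal_shift x m n :
  renewal (shift_seq m x) n = renewal x (m + n) - renewal x m.
Proof.
elim: n => [|n IHn]; first by rewrite addn0 renewal0 subrr.
by rewrite addnS !renewalS IHn /shift_seq addrAC.
Qed.

Lemma age_eq x t a : (exists2 n, a = t - renewal x n & 0 <= a) ->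
  (forall n, renewal x n <= t -> a <= t - renewal x n) -> age x t = a.
Proof.
move=> [n an a0] lba; apply/eqP; rewrite eq_le; apply/andP; split.
  by apply: ge_inf; [exists a => _ [k [-> ?]]; apply: lba; rewrite -subr_ge0|exists n].
apply: lb_le_inf; first by exists a, n.
by move=> _ [k [-> ?]]; apply: lba; rewrite -subr_ge0.
Qed.

Let age_set_lb x t : has_lbound [set z | exists n, z = t - renewal x n /\ 0 <= z].
Proof. by exists 0 => _ [n [-> ]]. Qed.

Lemma age_le x t n : renewal x n <= t -> age x t <= t - renewal x n.
Proof.
by move=> xt; apply: ge_inf; [exact: age_set_lb|exists n; rewrite subr_ge0].
Qed.

Lemma age_ge x t a : 0 <= t ->
  (forall n, renewal x n <= t -> a <= t - renewal x n) -> a <= age x t.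
Proof.
move=> t0 lba; apply: lb_le_inf; first by exists t, 0%N; rewrite renewal0 subr0.
by move=> _ [n [-> ?]]; apply: lba; rewrite -subr_ge0.
Qed.

Lemma age_ge0 x t : 0 <= t -> 0 <= age x t.
Proof. by move=> t0; apply: age_ge => // n; rewrite subr_ge0. Qed.

Lemma age_le_time x t : 0 <= t -> age x t <= t.
Proof. by move=> t0; rewrite -{2}(subr0 t) -(renewal0 x) age_le ?renewal0. Qed.

(** Late renewals are replaced by the value [t], already attained at [n = 0]. This countable infimum
    yields measurability in [x]. *)
Lemma age_inf x t : 0 <= t -> age x t =
  inf (range (fun n => if renewal x n <= t then t - renewal x n else t)).
Proof.
move=> t0; congr inf; apply/seteqP; split=> [_ [n [-> tn]]|_ [n _ <-]] /=.
  by exists n; rewrite // -subr_ge0 tn.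
by case: ifPn => ?; [exists n; rewrite subr_ge0|exists 0%N; rewrite renewal0 subr0].
Qed.

Context (x : nat -> R) (x_gt0 : forall n, 0 < x n).

Lemma renewal_mono m n : (m <= n)%N -> renewal x m <= renewal x n.
Proof.
move=> /subnK <-; elim: (n - m)%N => // k IH.
by rewrite addSn renewalS (le_trans IH)// lerDl ltW.
Qed.

Lemma renewal_ge0 n : 0 <= renewal x n.
Proof. by rewrite -(renewal0 x) renewal_mono. Qed.

(** Renewals before the [m]th only contribute larger values to the infimum. *)
Lemma age_shift m t : renewal x m <= t ->
  age x t = age (shift_seq m x) (t - renewal x m).
Proof.
move=> mt; have t0 : 0 <= t by apply: le_trans mt; exact: renewal_ge0.
apply/eqP; rewrite eq_le; apply/andP; split; apply: age_ge; rewrite ?subr_ge0//.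
  move=> n; rewrite renewal_shift => nt.
  apply: (le_trans (age_le (n := m + n) _)); lra.
move=> n nt; have [mn|/ltnW nm] := leqP m n.
  have /age_le : renewal (shift_seq m x) (n - m) <= t - renewal x m.
    by rewrite renewal_shift subnKC// lerD2r.
  by rewrite renewal_shift subnKC//; lra.
apply: (le_trans (age_le_time _ _)); rewrite ?subr_ge0//.
by rewrite lerD2l lerN2 renewal_mono.
Qed.

Lemma age_before_first t : 0 <= t < x 0%N -> age x t = t.
Proof.
move=> /andP[t0 tx]; apply: age_eq; first by exists 0%N; rewrite ?renewal0 ?subr0.
case=> [|n]; first by rewrite renewal0 subr0.
move=> xt; have := le_trans (@renewal_mono 1 n.+1 isT) xt.
by rewrite renewalS renewal0 add0r leNgt tx.
Qed.

End renewal_sequences.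

(** * Paths after a fixed time and after a hitting time *)

Section regeneration_paths.
Context {R : realType} (x : nat -> R) (x_gt0 : forall n, 0 < x n).

Let shift_gt0 m n : 0 < shift_seq m x n. Proof. exact: x_gt0. Qed.

Lemma age_between n t : renewal x n <= t < renewal x n.+1 ->
  age x t = t - renewal x n.
Proof.
move=> /andP[nt]; rewrite renewalS => tn.
rewrite (age_shift x_gt0 nt) age_before_first// /shift_seq addn0; apply/andP; split; lra.
Qed.

(** Pathwise Markov property: [renewal x n] is the last renewal up to [b], so [b - renewal x n] is
    the current age and the prepended entry is the residual gap. *)
Lemma age_markov n b u : renewal x n <= b < renewal x n.+1 -> 0 <= u ->
  age x (b + u) =
    age_from (b - renewal x n)
      (prepend (renewal x n.+1 - b) (shift_seq n.+1 x)) u.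
Proof.
move=> /andP[nb bn] u0; rewrite /age_from /=; set c := _ - b.
have c0 : 0 < c by rewrite subr_gt0.
have pos k : 0 < prepend c (shift_seq n.+1 x) k by case: k => [|k]; [exact: c0|exact: x_gt0].
case: ltP => uc.
  rewrite (age_before_first pos) ?u0// (@age_between n); first by rewrite /c; lra.
  by move: uc; rewrite /c => ?; apply/andP; split; lra.
(* Past the residual gap both sides restart at the same renewal: number [n.+1] of [x], number 1 of
   the prepended sequence. *)
rewrite addr0 (age_shift x_gt0 (m := n.+1)); last by move: uc; rewrite /c; lra.
rewrite (@age_shift _ _ pos 1%N) ?renewalS ?renewal0 ?add0r//=.
by congr age; rewrite /c renewalS; ring.
Qed.

Lemma renewal_interval t : 0 <= t -> (exists n, t < renewal x n) ->
  exists n, renewal x n <= t < renewal x n.+1.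
Proof.
move=> t0 tn; case: (ex_minnP tn) => -[|n]; first by rewrite renewal0 ltNge t0.
move=> nt min_n; exists n; rewrite nt andbT leNgt.
by apply/negP => /min_n; rewrite ltnn.
Qed.

Lemma age_lt n a t : (forall k, (k < n)%N -> x k <= a) ->
  0 <= t < renewal x n -> age x t < a.
Proof.
move=> xa /andP[t0 tn].
have [m /andP[mt tm]] := renewal_interval t0 (ex_intro _ n tn).
have mn : (m < n)%N.
  rewrite ltnNge; apply/negP => /(renewal_mono x_gt0) nm.
  by move: tn; rewrite ltNge (le_trans nm mt).
rewrite (@age_between m) ?mt//; apply: lt_le_trans (xa _ mn).
by move: tm; rewrite renewalS; lra.
Qed.

Definition hitting a : R := inf [set t | 0 <= t /\ age x t = a].

Lemma hitting_eq a t : 0 <= t -> age x t = a ->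
  (forall u, 0 <= u < t -> age x u != a) -> hitting a = t.
Proof.
move=> t0 ta na; have lb : lbound [set t | 0 <= t /\ age x t = a] t.
  move=> u [u0 ua]; rewrite leNgt; apply/negP => ut.
  by have := na u; rewrite u0 ut ua eqxx => /(_ isT).
apply/eqP; rewrite eq_le; apply/andP; split; first by apply: ge_inf; [exists t|].
by apply: lb_le_inf => //; exists t.
Qed.

Lemma hitting_never a : (forall u, 0 <= u -> age x u != a) -> hitting a = 0.
Proof.
move=> na; rewrite /hitting (_ : [set t | _] = set0) ?inf0//.
by apply/seteqP; split=> // u [/na/eqP].
Qed.

Lemma age_hitting_neg a u : a < 0 -> age x (hitting a + u) = age x u.
Proof.
move=> a0; rewrite hitting_never ?add0r// => t t0.
by apply/eqP => ta; move: a0; rewrite -ta ltNge age_ge0.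
Qed.

(** The level [a] is first reached inside the first gap longer than [a], at time [renewal x n + a];
    [age_markov] applies at that time. *)
Lemma age_hitting_crossing n a u : 0 <= a -> 0 <= u ->
  (forall k, (k < n)%N -> x k <= a) -> a < x n ->
  age x (hitting a + u) = age_from a (prepend (x n - a) (shift_seq n.+1 x)) u.
Proof.
move=> a0 u0 xa an; have r0 := renewal_ge0 x_gt0 n.
have bt : renewal x n <= renewal x n + a < renewal x n.+1.
  by rewrite renewalS lerDl a0 ltrD2l.
rewrite (@hitting_eq _ (renewal x n + a)) ?addr_ge0//.
- rewrite (age_markov bt u0) renewalS; congr (age_from _ (prepend _ _) _); lra.
- by rewrite (age_between bt); lra.
move=> t /andP[t0 tna]; have [nt|tn] := leP (renewal x n) t.
  by rewrite lt_eqF// (le_lt_trans (age_le nt))//; lra.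
by rewrite lt_eqF// (@age_lt n)// t0.
Qed.

(** The renewals accumulate at their supremum [S]. The age stays below [a] before [S] and equals
    [t - S] from [S] on, so [a] is hit at time [S + a]. *)
Lemma age_hitting_bounded a u : 0 <= a -> 0 <= u -> (forall k, x k <= a) ->
  has_ubound (range (renewal x)) -> age x (hitting a + u) = a + u.
Proof.
move=> a0 u0 xa ub; set S := sup (range (renewal x)).
have rS n : renewal x n <= S by apply: ub_le_sup => //; exists n.
have S0 : 0 <= S by rewrite (le_trans _ (rS 0%N))// renewal0.
have ageS t : S <= t -> age x t = t - S.
  move=> St; apply/eqP; rewrite eq_le; apply/andP; split; last first.
    by apply: age_ge => [|n _]; [exact: le_trans St|rewrite lerD2l lerN2].
  suff : S <= t - age x t by lra.
  apply: ge_sup; first by exists (renewal x 0%N), 0%N.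
  by move=> _ [n _ <-]; have := age_le (le_trans (rS n) St); lra.
rewrite (@hitting_eq _ (S + a)) ?addr_ge0//.
- by rewrite ageS; lra.
- by rewrite ageS; lra.
move=> t /andP[t0 tS]; have [St|tS'] := leP S t; first by rewrite ageS//; lra.
have rne : range (renewal x) !=set0 by exists (renewal x 0%N), 0%N.
have [_ [n _ <-] tn] := sup_gt rne tS'.
by rewrite lt_eqF// (@age_lt n)// t0.
Qed.

(** Every time precedes some renewal, so the age never reaches [a] and the hitting time is the
    default value 0. *)
Lemma age_hitting_unbounded a u : (forall k, x k <= a) ->
  ~ has_ubound (range (renewal x)) -> age x (hitting a + u) = age x u.
Proof.
move=> xa nub; rewrite hitting_never ?add0r// => t t0.
have [n tn] : exists n, t < renewal x n.
  apply: contrapT => nt; apply: nub; exists t => _ [n _ <-].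
  by rewrite leNgt; apply/negP => tn; apply: nt; exists n.
by rewrite lt_eqF// (@age_lt n)// t0.
Qed.

End regeneration_paths.

(** * Sequence space and factorization of laws *)

Section sequence_space.
Context {R : realType}.

Definition rectangle (C : nat -> set R) m : set (nat -> R) :=
  [set x | forall j, (j < m)%N -> C j (x j)].

(** A pi-system generating the product sigma-algebra on sequences; [seqR] is the resulting
    measurable type. *)
Definition rectangles : set_system (nat -> R) :=
  [set A | exists C m, (forall j, measurable (C j)) /\ A = rectangle C m].

Local Notation seqR := (g_sigma_algebraType rectangles).

Lemma setI_closed_rectangles : setI_closed rectangles.
Proof.
move=> _ _ [C [m [mC ->]]] [D [n [mD ->]]].
exists (fun j => (if (j < m)%N then C j else setT) `&`
                 (if (j < n)%N then D j else setT)), (maxn m n).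
split=> [j|]; first by apply: measurableI; case: ifP.
apply/seteqP; split=> [x [Cx Dx] j _|x CDx].
  by split; case: ifP => [?|_]//; [exact: Cx|exact: Dx].
by split=> j jn; have := CDx j; rewrite leq_max jn ?orbT => /(_ isT)[]; rewrite ?jn.
Qed.

Lemma rectangleT : rectangles setT.
Proof. by exists (fun=> setT), 0%N; split=> //; apply/seteqP; split. Qed.

Lemma measurable_rectangle C m : (forall j, measurable (C j)) ->
  measurable (rectangle C m : set seqR).
Proof. by move=> mC; apply: sub_sigma_algebra; exists C, m. Qed.

Lemma measurable_coord j : measurable_fun setT (fun x : seqR => x j).
Proof.
move=> _ A mA; rewrite setTI.
rewrite (_ : _ @^-1` _ = rectangle (fun k => if k == j then A else setT) j.+1).
  by apply: measurable_rectangle => k; case: ifP.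
apply/seteqP; split=> x /=; last by move=> /(_ j); rewrite ltnSn eqxx => /(_ isT).
by move=> Ax k _; case: eqP => // ->.
Qed.

Lemma measurable_to_seqR d (T : measurableType d) (f : T -> seqR) :
  (forall j, measurable_fun setT (fun t => f t j)) -> measurable_fun setT f.
Proof.
move=> mf; apply: (@measurability _ _ T seqR setT f rectangles) => // _ [_ [C [m [mC ->]]] <-].
rewrite setTI (_ : _ @^-1` _ =
  \bigcap_j (if (j < m)%N then (fun t => f t j) @^-1` C j else setT)).
  apply: bigcapT_measurable => j; case: ifP => // _.
  by rewrite -[X in measurable X]setTI; exact: mf.
apply/seteqP; split=> t /=.
  by move=> Ct j _; case: ifPn => // jm; exact: Ct.
by move=> Ct j jm; have := Ct j I; rewrite jm.
Qed.

Lemma measurable_renewal d (T : measurableType d) (f : T -> seqR) n :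
  measurable_fun setT f -> measurable_fun setT (fun t => renewal (f t) n).
Proof.
move=> mf; apply: measurable_sum => j.
exact: (measurableT_comp (measurable_coord j) mf).
Qed.

Lemma measurable_age d (T : measurableType d) (f : T -> seqR) u : 0 <= u ->
  measurable_fun setT f -> measurable_fun setT (fun t => age (f t) u).
Proof.
move=> u0 mf; pose h n t := if renewal (f t) n <= u then u - renewal (f t) n else u.
rewrite (_ : (fun _ => _) = fun t => infs (h ^~ t) 0); last first.
  apply/funext => t; rewrite age_inf// /infs; congr inf.
  by apply/seteqP; split=> [_ [n _ <-]|_ [n _ <-]]; exists n.
apply: measurable_fun_infs => [t _|n].
  by exists 0 => _ [n _ <-]; rewrite /h; case: ifP => //; rewrite subr_ge0.
apply: measurable_fun_ifT => //.
  by apply: measurable_fun_ler => //; exact: measurable_renewal.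
by apply: measurable_funB => //; exact: measurable_renewal.
Qed.

End sequence_space.

Notation seqR R := (g_sigma_algebraType (@rectangles R)).

(** Pi-lambda argument: since [G] contains the whole space, the constant sequence [setT] serves as
    the exhaustion. *)
Lemma finite_measure_unique {R : realType} d (T : measurableType d)
    (G : set_system T) (m1 m2 : {measure set T -> \bar R}) :
  setI_closed G -> G setT -> G `<=` measurable -> (m1 setT < +oo)%E ->
  (forall A, G A -> m1 A = m2 A) -> forall A, <<s G >> A -> m1 A = m2 A.
Proof.
move=> GI GT Gm m1T m12 A GA.
apply: (@g_sigma_algebra_measure_unique _ _ _ G Gm (fun=> setT)) => //.
by apply/seteqP; split => // x _; exists 0%N.
Qed.

Lemma probability_setI_as {R : realType} d (T : measurableType d)
    (P : probability T R) (U A : set T) :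
  measurable U -> measurable A -> P U = 1%E -> P (A `&` U) = P A.
Proof.
move=> mU mA PU.
rewrite (@measureDI _ _ _ P _ _ mA mU) [X in (X + _)%E](_ : _ = 0)%E ?add0e//.
apply/eqP; rewrite -measure_le0 (_ : 0%E = P (~` U)).
  by apply: le_measure; rewrite ?inE; [exact: measurableD|exact: measurableC|exact: subIsetr].
by rewrite probability_setC// PU subee.
Qed.

Section factorization.
Context {R : realType} d (T : measurableType d) (P : probability T R).
Context d' (S : measurableType d') (f g : T -> S).
Hypotheses (mf : measurable_fun setT f) (mg : measurable_fun setT g).

Let lawf := isMeasurableFun.Build _ _ _ _ _ mf.
Let f' : {mfun T >-> S} := HB.pack f lawf.
Let lawg := isMeasurableFun.Build _ _ _ _ _ mg.
Let g' : {mfun T >-> S} := HB.pack g lawg.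

(** Both sides are finite measures in [B]: the image under [f] of [P] restricted to [E], and a
    multiple of the image of [P] under [g]. With [E = setT] this compares two laws. *)
Lemma factorization_unique (E : set T) (G : set_system S) :
  measurable E -> setI_closed G -> G setT -> G `<=` measurable ->
  (forall B, G B -> P (E `&` f @^-1` B) = P E * P (g @^-1` B))%E ->
  forall B, <<s G >> B -> P (E `&` f @^-1` B) = (P E * P (g @^-1` B))%E.
Proof.
move=> mE GI GT Gm GE B GB.
have PE0 : (0 <= fine (P E))%R by rewrite fine_ge0.
pose q := NngNum PE0.
have qE : (q%:num%:E)%E = P E by rewrite /= fineK// fin_num_measure.
rewrite setIC -qE.
apply: (@finite_measure_unique _ _ _ G (pushforward (mrestr P mE) f')
  (mscale q (pushforward P g'))) => // {B GB}.
  rewrite -[X in (X < _)%E]/(P (setT `&` E)).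
  by rewrite setTI (le_lt_trans (probability_le1 P mE))// ltry.
move=> B GB; rewrite -[LHS]/(P (f @^-1` B `&` E)).
by rewrite -[RHS]/(q%:num%:E * P (g @^-1` B))%E setIC qE GE.
Qed.

End factorization.

(** * Integrating out an independent variable *)

Section freezing.
Context {R : realType} d (T : measurableType d) (P : probability T R).
Context d1 (T1 : measurableType d1) d2 (T2 : measurableType d2).
Context (U : T -> T1) (Y Y' : T -> T2).
Hypotheses (mU : measurable_fun setT U) (mY : measurable_fun setT Y)
  (mY' : measurable_fun setT Y').
(* [Y] is independent of [U] and distributed as [Y']. *)
Hypothesis UY : forall A D, measurable A -> measurable D ->
  P (U @^-1` A `&` Y @^-1` D) = (P (U @^-1` A) * P (Y' @^-1` D))%E.

Let lawU := isMeasurableFun.Build _ _ _ _ _ mU.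
Let U' : {RV P >-> T1} := HB.pack U lawU.
Let lawY := isMeasurableFun.Build _ _ _ _ _ mY'.
Let Y'' : {RV P >-> T2} := HB.pack Y' lawY.
Let mUY := measurable_fun_pair mU mY.
Let lawUY := isMeasurableFun.Build _ _ _ _ _ mUY.
Let UY' : {RV P >-> (T1 * T2)%type} := HB.pack (fun w => (U w, Y w)) lawUY.

Lemma measurable_section (Q : set (T1 * T2)) : measurable Q ->
  measurable_fun setT (fun u => P [set w | Q (u, Y' w)]).
Proof.
move=> mQ; have := measurable_fun_xsection (distribution P Y'') mQ.
by congr measurable_fun; apply/funext => u /=; rewrite /distribution /pushforward xsectionE.
Qed.

(** By independence the law of [(U, Y)] is the product of the laws of [U] and [Y'], and the measure
    of [Q] is the integral of its sections. *)
Lemma freezing (Q : set (T1 * T2)) : measurable Q ->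
  P [set w | Q (U w, Y w)] = (\int[P]_w P [set w' | Q (U w, Y' w')])%E.
Proof.
move=> mQ.
have E := @product_measure_unique _ _ _ _ _ (distribution P U') (distribution P Y'')
   (distribution P UY') UY _ mQ.
rewrite -[LHS]/(distribution P UY' Q) -E.
rewrite /product_measure1 ge0_integral_distribution//=; last first.
  exact: measurable_fun_xsection.
by apply: eq_integral => w _ /=; rewrite /distribution /pushforward xsectionE.
Qed.

End freezing.

(** * Independence of past and future gaps *)

Section filtration.
Context {R : realType} d (T : measurableType d) (P : probability T R).
Context (X : nat -> {RV P >-> R}).

(** A pi-system generating the sigma-algebra of the first [n] gaps. The type [pastT X n] is [T] with
    that sigma-algebra, so dependence on the past alone is expressed by [measurable_fun]. *)
Definition past_events n : set_system T :=
  [set A | exists C : nat -> set R, (forall j, measurable (C j)) /\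
     A = [set w | forall j, (j < n)%N -> C j (X j w)]].

Local Notation pastT n := (g_sigma_algebraType (past_events n)).

Definition gaps (w : T) : nat -> R := fun j => X j w.

Lemma setI_closed_past n : setI_closed (past_events n).
Proof.
move=> _ _ [C [mC ->]] [D [mD ->]]; exists (fun j => C j `&` D j).
split=> [j|]; first exact: measurableI.
apply/seteqP; split=> [w [Cw Dw] j jn|w CDw]; first by split; [exact: Cw|exact: Dw].
by split=> j /CDw[].
Qed.

Lemma past_eventsT n : past_events n setT.
Proof. by exists (fun=> setT); split=> //; apply/seteqP; split. Qed.

Lemma measurable_rectangle_tail n m (C : nat -> set R) :
  (forall j, measurable (C j)) ->
  measurable [set w | rectangle C m (shift_seq n (gaps w))].
Proof.
move=> mC; rewrite (_ : [set w | _] =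
    \bigcap_j (if (j < m)%N then X (n + j)%N @^-1` C j else setT)).
  apply: bigcapT_measurable => j; case: ifP => // _.
  by rewrite -[X in measurable X]setTI; exact: measurable_funPT.
apply/seteqP; split=> w /=.
  by move=> Ct j _; case: ifPn => // jm; exact: Ct.
by move=> Ct j jm; have := Ct j I; rewrite jm.
Qed.

Lemma past_events_measurable n : past_events n `<=` measurable.
Proof. by move=> _ [C [mC ->]]; exact: (@measurable_rectangle_tail 0). Qed.

Lemma past_measurable n A : <<s past_events n >> A -> measurable A.
Proof.
apply: smallest_sub; first exact: sigma_algebra_measurable.
exact: past_events_measurable.
Qed.

Lemma measurable_fun_past n d' (S : measurableType d') (V : T -> S) :
  measurable_fun setT (V : pastT n -> S) -> measurable_fun setT V.
Proof. by move=> mV _ B mB; apply: past_measurable; exact: mV. Qed.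

Lemma past_mono m n : (m <= n)%N -> <<s past_events m >> `<=` <<s past_events n >>.
Proof.
move=> mn; apply: sub_smallest2r; first exact: smallest_sigma_algebra.
move=> _ [C [mC ->]]; exists (fun j => if (j < m)%N then C j else setT).
split=> [j|]; first by case: ifP.
apply/seteqP; split=> w /= Cw j; first by case: ifP => // jm _; exact: Cw.
by move=> jm; have := Cw j; rewrite jm; apply; exact: leq_trans mn.
Qed.

Lemma measurable_fun_past_mono m n (V : T -> R) : (m <= n)%N ->
  measurable_fun setT (V : pastT m -> R) -> measurable_fun setT (V : pastT n -> R).
Proof. by move=> mn mV _ B mB; apply: (past_mono mn); exact: mV. Qed.

Lemma measurable_past_variable n j : (j < n)%N ->
  measurable_fun setT (X j : pastT n -> R).
Proof.
move=> jn _ B mB; rewrite setTI; apply: sub_sigma_algebra.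
exists (fun k => if k == j then B else setT); split=> [k|]; first by case: ifP.
apply/seteqP; split=> w /=; first by move=> Bw k _; case: eqP => // ->.
by move=> /(_ j jn); rewrite eqxx.
Qed.

Lemma measurable_gaps : measurable_fun setT (gaps : T -> seqR R).
Proof. by apply: measurable_to_seqR => j; exact: measurable_funPT. Qed.

End filtration.

Notation pastT X n := (g_sigma_algebraType (past_events X n)).

(** * Product formulas and independence of the tail *)

Section iid.
Context {R : realType} d (T : measurableType d) (P : probability T R).
Context (X : nat -> {RV P >-> R}).
Hypothesis X_ind : mutually_independent X.
Hypothesis X_id : forall j B, measurable B -> P (X j @^-1` B) = P (X 0%N @^-1` B).

Let p B := P (X 0%N @^-1` B).

Local Notation tail n w := (shift_seq n (gaps X w)).

Lemma probability_rectangle n m (C D : nat -> set R) :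
  (forall j, measurable (C j)) -> (forall j, measurable (D j)) ->
  P ([set w | rectangle C n (gaps X w)] `&`
     [set w | rectangle D m (tail n w)]) =
  ((\prod_(j < n) p (C j)) * (\prod_(j < m) p (D j)))%E.
Proof.
(* [B] lists the [n] sides of [C] and then those of [D], so the intersection is a single rectangle
   on the first [n + m] gaps. *)
move=> mC mD; pose B j := if (j < n)%N then C j else D (j - n)%N.
have mB j : measurable (B j) by rewrite /B; case: ifP.
rewrite (_ : _ `&` _ = \bigcap_(j in [set` iota 0 (n + m)]) (X j @^-1` B j)).
  rewrite X_ind ?iota_uniq// iotaD big_cat/=; congr (_ * _)%E.
    rewrite -[X in iota _ X]subn0 big_mkord.
    by apply: eq_bigr => j _; rewrite X_id// /B ltn_ord.
  rewrite add0n -{1}(addn0 n) iotaDl big_map -[X in iota _ X]subn0 big_mkord.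
  apply: eq_bigr => j _; rewrite X_id// /B ifF ?addKn//.
  by rewrite ltnNge leq_addr.
apply/seteqP; split=> w /=.
  move=> [Cw Dw] j; rewrite /= mem_iota add0n /B /preimage/= => jnm.
  case: ifPn => [|]; first exact: Cw.
  rewrite -leqNgt => nj; have := Dw (j - n)%N.
  by rewrite /shift_seq subnKC//; apply; rewrite ltn_subLR.
move=> Bw; split=> j jn.
  have := Bw j; rewrite /= mem_iota add0n ltn_addr// => /(_ isT).
  by rewrite /B /preimage /= jn.
have := Bw (n + j)%N; rewrite /= mem_iota add0n ltn_add2l jn => /(_ isT).
by rewrite /B /preimage /= ifF ?addKn// ltnNge leq_addr.
Qed.

Lemma probability_rectangle_tail n m (D : nat -> set R) :
  (forall j, measurable (D j)) ->
  P [set w | rectangle D m (tail n w)] = (\prod_(j < m) p (D j))%E.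
Proof.
move=> mD; have := @probability_rectangle n m (fun=> setT) D (fun=> measurableT) mD.
rewrite big1 => [|j _]; last by rewrite /p preimage_setT probability_setT.
by rewrite mul1e => <-; congr (P _); apply/seteqP; split => // w [].
Qed.

Lemma past_indep_rectangle n m (D : nat -> set R) A :
  (forall j, measurable (D j)) -> <<s past_events X n >> A ->
  P (A `&` [set w | rectangle D m (tail n w)]) =
  (P A * \prod_(j < m) p (D j))%E.
Proof.
move=> mD pA; rewrite -(probability_rectangle_tail n m mD) muleC setIC.
(* The tail event is the fixed set and the past event varies, so both maps are the identity, viewed
   as a map into [pastT X n]. *)
apply: (@factorization_unique _ _ _ P _ (pastT X n) idfun idfun _ _
  [set w | rectangle D m (tail n w)] (past_events X n) _ _ _ _ _ A) => //.
- by move=> _ B /past_measurable mB; rewrite setTI.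
- by move=> _ B /past_measurable mB; rewrite setTI.
- exact: measurable_rectangle_tail.
- exact: (@setI_closed_past _ _ _ _ X n).
- exact: (@past_eventsT _ _ _ _ X n).
- exact: sub_sigma_algebra.
move=> _ [C [mC ->]]; rewrite setIC [LHS]probability_rectangle//.
by rewrite muleC probability_rectangle_tail// -(probability_rectangle_tail 0 n mC).
Qed.

Lemma past_indep n B A : measurable B -> <<s past_events X n >> A ->
  P (A `&` X n @^-1` B) = (P A * p B)%E.
Proof.
move=> mB pA; have := @past_indep_rectangle n 1 (fun=> B) A (fun=> mB) pA.
rewrite big_ord1 => <-; congr (P (_ `&` _)); apply/seteqP; split=> w /=.
  by move=> Bw [|//] _; rewrite /shift_seq addn0.
by move=> /(_ 0%N isT); rewrite /shift_seq addn0.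
Qed.

End iid.

(** * Regeneration at a threshold crossing *)

Section exponential_tail.
Context {R : realType} d (T : measurableType d) (P : probability T R).
Context (lambda : R) (X : nat -> {RV P >-> R}).
Hypothesis X_iid : iid_exponential lambda X.

Lemma iid_exponential_gt0 j w : 0 < X j w.
Proof. by case: X_iid. Qed.

Lemma iid_exponential_indep : mutually_independent X.
Proof. by case: X_iid. Qed.

Lemma iid_exponential_id j B : measurable B -> P (X j @^-1` B) = P (X 0%N @^-1` B).
Proof. by case: X_iid => _ _ XE mB; exact: etrans (XE j B mB) (esym (XE 0%N B mB)). Qed.

Lemma measurable_above j c : measurable [set w | c < X j w].
Proof.
rewrite (_ : [set w | _] = X j @^-1` `]c, +oo[%classic).
  by rewrite -[X in measurable X]setTI; exact: measurable_funPT.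
by apply/seteqP; split=> w /=; rewrite in_itv/= andbT.
Qed.

Lemma exponential_tail c : 0 <= c ->
  P [set w | c < X 0%N w] = (expR (- lambda * c))%:E.
Proof.
rewrite le_eqVlt => /predU1P[<-|c0].
  rewrite mulr0 expR0 -(probability_setT P); congr (P _).
  by apply/seteqP; split => // w _; exact: iid_exponential_gt0.
have -> : [set w | c < X 0%N w] = ~` (X 0%N @^-1` `[0, c]%classic).
  apply/seteqP; split=> w /=; rewrite in_itv/= ltW ?iid_exponential_gt0//=.
    by move=> cX; apply/negP; rewrite -ltNge.
  by move/negP; rewrite -ltNge.
rewrite probability_setC; last first.
  by rewrite -[X in measurable X]setTI; exact: measurable_funPT.
case: X_iid => _ _ XE; have := XE 0%N _ (measurable_itv `[0, c]).
rewrite -[LHS]/(P (X 0%N @^-1` `[0, c]%classic)) => ->.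
rewrite exponential_prob_itv0c//; rewrite -!EFinB; congr EFin; ring.
Qed.

Lemma exponential_tailD v c : 0 <= v -> 0 <= c ->
  P [set w | v + c < X 0%N w] =
  (P [set w | (v < X 0%N w)%R] * P [set w | (c < X 0%N w)%R])%E.
Proof.
move=> v0 c0; rewrite !exponential_tail ?addr_ge0// -EFinM -expRD.
by congr (expR _)%:E; ring.
Qed.

(** It is enough to test [C] on open half-lines, where the claim is the multiplicativity of the
    exponential tail. *)
Lemma exponential_memoryless v (C : set R) : 0 <= v -> measurable C ->
  P ([set w | v < X 0%N w] `&` [set w | C (X 0%N w - v)]) =
  (P [set w | (v < X 0%N w)%R] * P (X 0%N @^-1` C))%E.
Proof.
move=> v0 mC.
have mX : measurable_fun setT (fun w => X 0%N w - v).
  by apply: measurable_funB => //; exact: measurable_funPT.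
(* [setT] is added to the half-lines because the uniqueness argument needs it in the pi-system. *)
pose G := [set A : set R | A = setT \/ exists c, A = `]c, +oo[%classic].
have GC : <<s G >> C.
  have : (@ocitv R).-sigma.-measurable C by exact: mC.
  rewrite RGenOInfty.measurableE.
  apply: sub_smallest2r; first exact: smallest_sigma_algebra.
  by move=> A [c ->]; right; exists c.
move: C GC {mC}; apply: (factorization_unique mX) => //.
- exact: measurable_above.
- move=> A B [->|[a ->]] [->|[b ->]]; rewrite ?setTI ?setIT; first by left.
  + by right; exists b.
  + by right; exists a.
  + right; exists (Num.max a b); apply/seteqP; split=> x /=.
      by rewrite !in_itv/= !andbT gt_max => -[-> ->].
    by rewrite !in_itv/= !andbT gt_max => /andP[].
- by left.
- by move=> A [->|[a ->]].
move=> B [->|[c ->]].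
  by rewrite !preimage_setT setIT probability_setT mule1.
have E a : X 0%N @^-1` `]a, +oo[%classic = [set w | a < X 0%N w].
  by apply/seteqP; split=> w /=; rewrite in_itv/= andbT.
rewrite E; have [c0|c0] := leP 0 c.
  rewrite -exponential_tailD//; congr (P _); apply/seteqP; split=> w /=.
    by rewrite in_itv/= andbT => -[_]; rewrite ltrBrDl.
  by rewrite in_itv/= andbT ltrBrDl => vc; split=> //; apply: le_lt_trans vc; rewrite lerDl.
(* For negative [c] the constraint is void: gaps are positive, and so is the excess once the
   threshold is exceeded. *)
rewrite [X in (_ * P X)%E](_ : _ = setT) ?probability_setT ?mule1; last first.
  by apply/seteqP; split=> // w _ /=; exact: lt_trans c0 (iid_exponential_gt0 _ _).
congr (P _); apply/seteqP; split=> [w []//|w /= vw]; split=> //.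
by rewrite in_itv/= andbT (lt_trans c0)// subr_gt0.
Qed.

End exponential_tail.

(** * Excess over a threshold determined by the past *)

Section residual.
Context {R : realType} d (T : measurableType d) (P : probability T R).
Context (lambda : R) (X : nat -> {RV P >-> R}).
Hypothesis X_iid : iid_exponential lambda X.
Context (n : nat) (V : T -> R).
Hypotheses (V_ge0 : forall w, 0 <= V w)
  (mV : measurable_fun setT (V : pastT X n -> R)).

Let mVT : measurable_fun setT V := measurable_fun_past mV.

Let mX j : measurable_fun setT (X j). Proof. exact: measurable_funPT. Qed.

Let X_ind := iid_exponential_indep X_iid.
Let X_id := iid_exponential_id X_iid.

(** The gap [X n] is independent of the past, so freezing the past turns [V] into a constant, for
    which [exponential_memoryless] holds pointwise under the integral. *)
Lemma residual_law (A : set T) (C : set R) :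
  <<s past_events X n >> A -> measurable C ->
  P (A `&` [set w | V w < X n w] `&` [set w | C (X n w - V w)]) =
  (P (A `&` [set w | (V w < X n w)%R]) * P (X 0%N @^-1` C))%E.
Proof.
move=> pA mC.
pose Q D : set (pastT X n * R) :=
  [set u | [/\ A u.1, V u.1 < u.2 & D (u.2 - V u.1)]].
have mQ D : measurable D -> measurable (Q D).
  move=> mD; rewrite (_ : Q D = (fst @^-1` A) `&`
      ([set u | V u.1 < u.2] `&` (fun u => u.2 - V u.1) @^-1` D)).
    have mV1 : measurable_fun setT (fun u : pastT X n * R => V u.1).
      exact: (measurableT_comp mV measurable_fst).
    apply: measurableI.
      by rewrite -[X in measurable X]setTI; exact: measurable_fst.
    apply: measurableI.
      have := @measurable_fun_ltr _ _ _ setT _ _ mV1 measurable_snd.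
      by move=> /(_ measurableT [set true] I); rewrite setTI.
    rewrite -[X in measurable X]setTI.
    by apply: (measurable_funB measurable_snd mV1).
  by apply/seteqP; split=> u /= [? []].
have fr D : measurable D ->
    P (A `&` [set w | V w < X n w] `&` [set w | D (X n w - V w)]) =
    (\int[P]_w P [set w' | Q D (w, X 0%N w')])%E.
  move=> mD.
  rewrite -(@freezing _ _ _ P _ (pastT X n) _ _ idfun (X n) (X 0%N) _ _ _ _ (Q D))//.
  - by congr (P _); apply/seteqP; split=> w /=; [case=> -[]|case].
  - by move=> _ B /past_measurable mB; rewrite setTI.
  - by move=> B E pB mE; rewrite preimage_id; exact: past_indep.
  - exact: mQ.
(* The case [D = setT] writes the first factor as an integral of the same kind, leaving only
   integrands to compare. *)
have QT : P (A `&` [set w | V w < X n w]) =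
    (\int[P]_w P [set w' | Q setT (w, X 0%N w')])%E.
  by rewrite -fr//; congr (P _); apply/seteqP; split=> w /= [].
have mQT : measurable_fun [set: T] (fun w : T => P [set w' | Q setT (w, X 0%N w')]).
  apply: (@measurable_fun_past _ _ _ _ X n).
  exact: (@measurable_section _ _ _ P _ (pastT X n) _ _ _ (mX 0) _ (mQ _ measurableT)).
rewrite fr// QT -ge0_integralZr//; apply: eq_integral => w _.
have [Aw|nAw] := pselect (A w); last first.
  rewrite [X in P X](_ : _ = set0) ?measure0; last by apply/seteqP; split=> w' // [].
  rewrite [X in (P X * _)%E](_ : _ = set0) ?measure0 ?mul0e//.
  by apply/seteqP; split=> w' // [].
have := exponential_memoryless X_iid (V_ge0 w) mC; congr (_ = _ * _)%E.
  by congr (P _); apply/seteqP; split=> w' /= [].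
by congr (P _); apply/seteqP; split=> w' //= [].
Qed.

(** On a rectangle, the first side constrains the excess, handled by [residual_law]; the other sides
    constrain gaps independent of the first [n.+1]. *)
Lemma residual_gaps_law (A : set T) (D : set (seqR R)) :
  <<s past_events X n >> A -> measurable D ->
  P (A `&` [set w | V w < X n w] `&`
     [set w | D (prepend (X n w - V w) (shift_seq n.+1 (gaps X w)))]) =
  (P (A `&` [set w | (V w < X n w)%R]) * P [set w | D (gaps X w)])%E.
Proof.
move=> pA mD.
have mVS : measurable_fun setT (V : pastT X n.+1 -> R).
  exact: measurable_fun_past_mono mV.
have mXS : measurable_fun setT (X n : pastT X n.+1 -> R).
  exact: measurable_past_variable.
have pE : <<s past_events X n.+1 >> (A `&` [set w | V w < X n w]).
  apply: (@measurableI _ (pastT X n.+1)); first exact: past_mono pA.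
  have := measurable_fun_ltr mVS mXS.
  by move=> /(_ measurableT [set true] I); rewrite setTI.
apply: (@factorization_unique _ _ _ P _ (seqR R)
  (fun w => prepend (X n w - V w) (shift_seq n.+1 (gaps X w))) (gaps X)
  _ _ _ (@rectangles R) _ _ _ _ _ D) => //.
- apply: measurable_to_seqR => -[|j] /=; first by apply: measurable_funB.
  exact: mX.
- exact: measurable_gaps.
- exact: past_measurable pE.
- exact: setI_closed_rectangles.
- exact: rectangleT.
- exact: sub_sigma_algebra.
move=> _ [C [[|m] [mC ->]]].
  have r0 x : rectangle C 0 x = True by apply/propext; split.
  rewrite [X in _ `&` X](_ : _ = setT); last by apply/seteqP; split=> w //= _; rewrite r0.
  rewrite [X in (_ * P X)%E](_ : _ = setT); last by apply/seteqP; split=> w //= _; rewrite r0.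
  by rewrite setIT probability_setT mule1.
rewrite [X in (_ * P X)%E](_ : _ = [set w | rectangle C m.+1 (shift_seq 0 (gaps X w))])//.
rewrite (probability_rectangle_tail X_ind X_id)// big_ord_recl muleA.
rewrite -residual_law//.
rewrite -(past_indep_rectangle X_ind X_id m (D := fun j => C j.+1) (n := n.+1))//.
  congr (P _); apply/seteqP; split=> w /=.
    move=> [Ew Cw]; split; last by move=> j jm; exact: (Cw j.+1).
    by split=> //; exact: (Cw 0%N).
  by move=> [[Ew C0] Cw]; split=> // -[|j] jm //=; exact: Cw.
apply: (@measurableI _ (pastT X n.+1)) => //.
by have := measurable_funB mXS mVS => /(_ measurableT _ (mC 0%N)); rewrite setTI.
Qed.

End residual.

Lemma measurable_fun_glue d (T : measurableType d) d' (S : measurableType d')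
    (f : nat -> T -> S) (N : T -> nat) :
  (forall n, measurable_fun setT (f n)) ->
  (forall n, measurable [set t | N t = n]) ->
  measurable_fun setT (fun t => f (N t) t).
Proof.
move=> mf mN _ B mB; rewrite setTI.
rewrite (_ : _ @^-1` B = \bigcup_n ([set t | N t = n] `&` f n @^-1` B)).
  apply: bigcupT_measurable => n; apply: measurableI => //.
  by rewrite -[X in measurable X]setTI; exact: mf.
by apply/seteqP; split=> [t Bt|t [n _ [/= ->]]//]; exists (N t).
Qed.

(** * First crossing of a sequence of thresholds *)

Section regeneration.
Context {R : realType} d (T : measurableType d) (P : probability T R).
Context (lambda : R) (X : nat -> {RV P >-> R}).
Hypothesis X_iid : iid_exponential lambda X.
Context (V : nat -> T -> R).
Hypotheses (V_ge0 : forall n w, 0 <= V n w)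
  (mV : forall n, measurable_fun setT (V n : pastT X n -> R)).

Definition crossing n : set T :=
  [set w | (forall k, (k < n)%N -> X k w <= V k w) /\ V n w < X n w].

(* [0] on the null event where the thresholds are never crossed. *)
Definition crossing_index w : nat := xget 0%N [set n | crossing n w].

Definition overshoot n w : nat -> R :=
  prepend (X n w - V n w) (shift_seq n.+1 (gaps X w)).

Let below n : set T := [set w | forall k, (k < n)%N -> X k w <= V k w].

Let crossingE n : crossing n = below n `&` [set w | V n w < X n w].
Proof. by apply/seteqP; split. Qed.

Lemma crossing_unique m n w : crossing m w -> crossing n w -> m = n.
Proof.
move=> [bm vm] [bn vn]; apply/eqP; rewrite eqn_leq; apply/andP; split.
  by rewrite leqNgt; apply/negP => /bm; rewrite leNgt vn.
by rewrite leqNgt; apply/negP => /bn; rewrite leNgt vm.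
Qed.

Lemma crossing_indexE n w : crossing n w -> crossing_index w = n.
Proof.
move=> nw; rewrite /crossing_index; case: xgetP => [_ -> mw|/(_ n)//].
exact: crossing_unique mw nw.
Qed.

Lemma below_past n : <<s past_events X n >> (below n).
Proof.
rewrite (_ : below n =
    \bigcap_k (if (k < n)%N then [set w | X k w <= V k w] else setT)); last first.
  apply/seteqP; split=> w /=; first by move=> bw k _; case: ifP => // /bw.
  by move=> bw k kn; have := bw k I; rewrite kn.
apply: (@bigcapT_measurable _ (pastT X n)) => k; case: ifP => // kn.
have := measurable_fun_ler (measurable_past_variable (X := X) kn)
  (measurable_fun_past_mono (ltnW kn) (@mV k)).
by move=> /(_ measurableT [set true] I); rewrite setTI.
Qed.

Lemma measurable_crossing n : measurable (crossing n).
Proof.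
rewrite crossingE; apply: measurableI; first exact: (past_measurable (@below_past n)).
have := measurable_fun_ltr (measurable_fun_past (@mV n)) (@measurable_funPT _ _ _ _ (X n)).
by move=> /(_ measurableT [set true] I); rewrite setTI.
Qed.

Lemma measurable_crossing_index n : measurable [set w | crossing_index w = n].
Proof.
rewrite (_ : [set w | _] = crossing n `|`
    (if n == 0%N then ~` \bigcup_k crossing k else set0)).
  apply: measurableU; first exact: measurable_crossing.
  case: ifP => // _; apply: measurableC; apply: bigcupT_measurable.
  exact: measurable_crossing.
apply/seteqP; split=> w /=.
  have [[m mw]|nw] := pselect (exists m, crossing m w).
    by rewrite (crossing_indexE mw) => <-; left.
  rewrite /crossing_index xgetPN => [<-|m]; last by move=> mw; apply: nw; exists m.
  by right=> -[m _ mw]; apply: nw; exists m.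
move=> [/crossing_indexE//|]; case: eqP => // -> nw.
by rewrite /crossing_index xgetPN// => m mw; apply: nw; exists m.
Qed.

Lemma measurable_crossing_threshold :
  measurable_fun setT (fun w => V (crossing_index w) w).
Proof.
apply: measurable_fun_glue; last exact: measurable_crossing_index.
by move=> n; exact: measurable_fun_past (@mV n).
Qed.

Lemma measurable_overshoot :
  measurable_fun setT (fun w => overshoot (crossing_index w) w : seqR R).
Proof.
apply: (@measurable_fun_glue _ _ _ (seqR R) overshoot); last exact: measurable_crossing_index.
move=> n; apply: measurable_to_seqR => -[|j] /=; last exact: measurable_funPT.
apply: measurable_funB; first exact: measurable_funPT.
exact: measurable_fun_past (@mV n).
Qed.

Hypothesis crossing_as : P (\bigcup_n crossing n) = 1%E.

Lemma probability_crossing (W : set T) : measurable W ->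
  P W = (\sum_(n <oo) P (W `&` crossing n))%E.
Proof.
move=> mW; have mU : measurable (\bigcup_n crossing n).
  by apply: bigcupT_measurable; exact: measurable_crossing.
rewrite -(probability_setI_as mU mW crossing_as).
rewrite setI_bigcupr measure_bigcup//.
- by apply: eq_eseriesl => n; rewrite in_setT.
- by move=> n _; apply: measurableI => //; exact: measurable_crossing.
- by move=> m n _ _ [w [[_ mw] [_ nw]]]; exact: crossing_unique mw nw.
Qed.

Let U w := V (crossing_index w) w.
Let Y w := overshoot (crossing_index w) w.

Let mU : measurable_fun setT U := measurable_crossing_threshold.
Let mY : measurable_fun setT (Y : T -> seqR R) := measurable_overshoot.

(** Split along the crossing index. On [crossing n] the threshold event belongs to the past of [n],
    so [residual_gaps_law] gives every term of the series the same factor. *)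
Let UY (B : set R) (D : set (seqR R)) : measurable B -> measurable D ->
  P (U @^-1` B `&` Y @^-1` D) = (P (U @^-1` B) * P (gaps X @^-1` D))%E.
Proof.
move=> mB mD.
have mUB : measurable (U @^-1` B) by rewrite -[X in measurable X]setTI; exact: mU.
have mYD : measurable (Y @^-1` D) by rewrite -[X in measurable X]setTI; exact: mY.
rewrite (probability_crossing mUB) (probability_crossing (measurableI _ _ mUB mYD)).
have mGD : measurable (gaps X @^-1` D).
  by rewrite -[X in measurable X]setTI; exact: (measurable_gaps X).
have pD : (fine (P (gaps X @^-1` D)))%:E = P (gaps X @^-1` D).
  by rewrite fineK ?fin_num_measure.
rewrite muleC -pD -nneseriesZl//; apply: eq_eseriesr => n _; rewrite pD muleC.
have UB : U @^-1` B `&` crossing n = (below n `&` V n @^-1` B) `&` [set w | V n w < X n w].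
  apply/seteqP; split=> w /=.
    by move=> [Bw [bw vw]]; do !split=> //; move: Bw; rewrite /preimage/= /U (@crossing_indexE n).
  by move=> [[bw Bw] vw]; split; rewrite /preimage/= /U ?(@crossing_indexE n).
rewrite UB (setIAC (U @^-1` B)) UB.
rewrite -(residual_gaps_law X_iid (V_ge0 n) (@mV n)) //.
  congr (P _); apply/seteqP; split=> w /=.
    move=> [[[bw Bw] vw] Dw]; do !split => //.
    by move: Dw; rewrite /preimage/= /Y (@crossing_indexE n).
  by move=> [[[bw Bw] vw] Dw]; do !split => //; rewrite /preimage/= /Y (@crossing_indexE n).
apply: (@measurableI _ (pastT X n)); first exact: below_past.
by have := @mV n => /(_ measurableT _ mB); rewrite setTI.
Qed.

Lemma regeneration (Q : set (R * seqR R)) : measurable Q ->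
  P [set w | Q (V (crossing_index w) w, overshoot (crossing_index w) w)] =
  (\int[P]_w P [set w' | Q (V (crossing_index w) w, gaps X w')])%E.
Proof. by apply: (freezing mU mY _ UY); exact: measurable_gaps. Qed.

End regeneration.

(** * Laws of the growing process *)

Section cylinder_sets.
Context {R : realType}.

Lemma sigma_algebra_cylinders (D : set R) : sigma_algebra setT (cylinders D).
Proof. exact: smallest_sigma_algebra. Qed.

(** The sets with measurable preimage form a sigma-algebra, so measurability of each coordinate
    suffices. *)
Lemma cylinders_preimage d (S : measurableType d) (D : set R) (F : S -> R -> R) B :
  (forall u, D u -> measurable_fun setT (fun s => F s u)) ->
  cylinders D B -> measurable [set s | B (F s)].
Proof.
move=> mF; rewrite -[X in measurable X]/(F @^-1` B).
apply: (@smallest_sub _ _ _ [set B | measurable (F @^-1` B)]); last first.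
  move=> A [u Du [C mC <-]] /=; rewrite setTI -comp_preimage.
  by rewrite -[X in measurable X]setTI; exact: mF.
split=> /= [|A mA|G mG]; first by rewrite preimage_set0.
  by rewrite setTD preimage_setC; exact: measurableC.
by rewrite preimage_bigcup; exact: bigcupT_measurable.
Qed.

Lemma cylinders_coord (D : set R) u C : D u -> measurable C ->
  cylinders D [set f : R -> R | C (f u)].
Proof.
by move=> Du mC; apply: sub_sigma_algebra; exists u => //; exists C => //; rewrite setTI.
Qed.

Lemma cylinders_subset (D E : set R) : D `<=` E -> cylinders D `<=` @cylinders R E.
Proof.
move=> DE; apply: sub_smallest2r; first exact: sigma_algebra_cylinders.
by move=> A [u /DE Eu uA]; exists u.
Qed.

(** The sets that do not separate [f] from [g] form a sigma-algebra containing the generators. *)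
Lemma cylinders_ext (D : set R) B f g : cylinders D B ->
  (forall u, D u -> f u = g u) -> B f = B g.
Proof.
move=> + fg; apply: (@smallest_sub _ _ _ [set B | B f = B g]); last first.
  by move=> A [u Du [C mC <-]]; rewrite /= /setI /preimage /= fg.
split=> //= [A AE|G GE]; apply/propext.
  by split=> -[_ nA]; split=> //; [rewrite -AE|rewrite AE].
by split=> -[n _ Gn]; exists n => //; [rewrite -GE|rewrite GE].
Qed.

End cylinder_sets.

(** * Markov property and one-dimensional laws *)

Section timing_law.
Context {R : realType} d (T : measurableType d) (P : probability T R).
Context (lambda : R) (X : nat -> {RV P >-> R}).
Hypotheses (lambda_gt0 : 0 < lambda) (X_iid : iid_exponential lambda X).

Let X_gt0 w n : 0 < gaps X w n. Proof. exact: (iid_exponential_gt0 X_iid). Qed.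

Lemma integral_probability_cst (c : \bar R) : (\int[P]_w c = c)%E.
Proof.
by rewrite integral_cst// -[RHS]mule1; congr (_ * _)%E; exact: probability_setT.
Qed.

Lemma probability_eq_as (U A B : set T) : measurable U -> measurable A ->
  measurable B -> P U = 1%E -> U `&` A = U `&` B -> P A = P B.
Proof.
move=> mU mA mB PU AB.
by rewrite -(probability_setI_as mU mA PU) setIC AB setIC probability_setI_as.
Qed.

Lemma measurable_never_above a : measurable [set w | forall k, X k w <= a].
Proof.
rewrite (_ : [set w | _] = \bigcap_k (~` [set w | a < X k w])).
  by apply: bigcapT_measurable => k; apply: measurableC; exact: measurable_above.
apply/seteqP; split=> w /=; first by move=> Nw k _; rewrite /= ltNge Nw.
by move=> Nw k; rewrite leNgt; apply/negP; exact: Nw.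
Qed.

(** A gap is at most [a] with probability [q < 1], so the first [n] gaps all are with probability
    [q ^+ n], which tends to 0. *)
Lemma never_above (a : R) : 0 <= a -> P [set w | forall k, X k w <= a] = 0%E.
Proof.
move=> a0; set N := [set w | _].
have mN : measurable N by exact: measurable_never_above.
set q := 1 - expR (- lambda * a).
have q0 : 0 <= q by rewrite subr_ge0 -[leRHS]expR0 ler_expR mulNr oppr_le0 mulr_ge0// ltW.
have q1 : q < 1 by rewrite ltrBlDr ltrDl expR_gt0.
have mC : measurable (`]-oo, a]%classic : set R) by [].
have Pq : P (X 0%N @^-1` `]-oo, a]%classic) = q%:E.
  rewrite (_ : _ @^-1` _ = ~` [set w | a < X 0%N w]).
    rewrite probability_setC; last exact: measurable_above.
    by rewrite (exponential_tail X_iid a0).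
  by apply/seteqP; split=> w /=; rewrite in_itv/= leNgt => /negP.
have Nq n : (P N <= (q ^+ n)%:E)%E.
  have -> : (q ^+ n)%:E = (\prod_(j < n) P (X 0%N @^-1` `]-oo, a]%classic))%E.
    by rewrite Pq prodEFin big_const_ord iter_mulr_1.
  rewrite -(probability_rectangle_tail (iid_exponential_indep X_iid)
    (iid_exponential_id X_iid) 0 n (fun=> mC))//.
  apply: le_measure; rewrite ?inE//; first exact: measurable_rectangle_tail.
  by move=> w Nw j _; rewrite /= in_itv/=; exact: Nw.
have Pf : P N \is a fin_num by rewrite fin_num_measure.
rewrite -(fineK Pf); congr EFin; apply/eqP; rewrite eq_le fine_ge0// andbT.
have qn : (fun n => q ^+ n) @ \oo --> (0 : R).
  by apply: cvg_expr; rewrite ger0_norm.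
rewrite -(cvg_lim _ qn)//; apply: limr_ge; first by apply/cvg_ex; exists 0.
by apply: nearW => n; rewrite -lee_fin fineK.
Qed.

Section bounded_thresholds.
Context (a : R) (V : nat -> T -> R).
Hypotheses (a_ge0 : 0 <= a) (V_le : forall n w, V n w <= a)
  (mV : forall n, measurable_fun setT (V n : pastT X n -> R)).

Lemma no_crossing w : ~ (\bigcup_n crossing X V n) w -> forall k, X k w <= a.
Proof.
move=> nw; suff XV n : X n w <= V n w by move=> k; exact: le_trans (V_le k w).
elim/ltn_ind: n => n IH; rewrite leNgt; apply/negP => Vn.
by apply: nw; exists n.
Qed.

(** If no threshold is crossed, every gap is at most [a], a null event by [never_above]. *)
Lemma crossing_as : P (\bigcup_n crossing X V n) = 1%E.
Proof.
have mU : measurable (\bigcup_n crossing X V n).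
  by apply: bigcupT_measurable => n; exact: measurable_crossing.
have : P (~` \bigcup_n crossing X V n) = 0%E.
  apply/eqP; rewrite -measure_le0 -(never_above a_ge0).
  apply: le_measure; rewrite ?inE; [exact: measurableC| |exact: no_crossing].
  exact: measurable_never_above.
by move=> U0; rewrite -[X in P X]setCK probability_setC ?U0 ?sube0//; exact: measurableC.
Qed.

End bounded_thresholds.

Lemma measurable_timing (t : R) : 0 <= t -> measurable_fun setT (timing X t).
Proof. by move=> t0; exact: (measurable_age t0 (measurable_gaps X)). Qed.

Lemma measurable_age_from (u : R) : 0 <= u ->
  measurable_fun setT (fun p : R * seqR R => age_from p.1 p.2 u).
Proof.
move=> u0; apply: measurable_funD; first exact: (measurable_age u0 measurable_snd).
apply: measurable_fun_ifT => //.
by apply: measurable_fun_ltr => //; exact: (measurableT_comp (measurable_coord 0) measurable_snd).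
Qed.

Definition age_paths (r : R) (B : set (R -> R)) : set (R * seqR R) :=
  [set p | B (fun u => r * age_from p.1 p.2 u)].

Lemma measurable_age_paths r B : cylinders `[0, +oo[ B -> measurable (age_paths r B).
Proof.
apply: (@cylinders_preimage _ _ (R * seqR R)%type _
  (fun p u => r * age_from p.1 p.2 u)) => u; rewrite /= in_itv/= andbT => u0.
by apply: measurable_funM => //; exact: measurable_age_from.
Qed.

(** The transition kernel of the growing process, parametrized by the initial age [a] instead of the
    length [r * a]. *)
Definition law_from r B (a : R) : \bar R :=
  P [set w | age_paths r B (a, gaps X w)].

Lemma measurable_law_from r B : cylinders `[0, +oo[ B ->
  measurable_fun setT (law_from r B).
Proof.
move=> /(measurable_age_paths r) mQ.
exact: (@measurable_section _ _ _ P _ R _ (seqR R) (gaps X) (measurable_gaps X)).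
Qed.

Section regenerative_paths.
Context (a : R) (V : nat -> T -> R).
Hypotheses (a_ge0 : 0 <= a) (V_ge0 : forall n w, 0 <= V n w)
  (V_le : forall n w, V n w <= a)
  (mV : forall n, measurable_fun setT (V n : pastT X n -> R)).

Lemma measurable_crossings : measurable (\bigcup_n crossing X V n).
Proof. by apply: bigcupT_measurable => n; exact: (measurable_crossing mV). Qed.

(** Shared by the process observed from a fixed time and the process started at a level: both are,
    almost surely, the age process built on an overshoot, so [regeneration] applies. *)
Lemma regenerative_path_law (Z : R -> T -> R) r B :
  (forall u, 0 <= u -> measurable_fun setT (Z u)) ->
  (forall n w u, crossing X V n w -> 0 <= u ->
     Z u w = age_from (V n w) (overshoot X V n w) u) ->
  cylinders `[0, +oo[ B ->
  P [set w | B (fun u => r * Z u w)] =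
  (\int[P]_w law_from r B (V (crossing_index X V w) w))%E.
Proof.
move=> mZ ZE cB; have mQ := measurable_age_paths r cB.
have as1 := crossing_as a_ge0 V_le mV.
rewrite -(regeneration X_iid V_ge0 mV as1 mQ).
apply: (probability_eq_as measurable_crossings _ _ as1).
- apply: (cylinders_preimage (F := fun w u => r * Z u w) _ cB) => u.
  by rewrite /= in_itv/= andbT => u0; apply: measurable_funM => //; exact: mZ.
- have := measurable_fun_pair (measurable_crossing_threshold mV) (measurable_overshoot mV).
  by move=> /(_ measurableT _ mQ); rewrite setTI.
have E w : (\bigcup_n crossing X V n) w ->
    B (fun u => r * Z u w) = age_paths r B
      (V (crossing_index X V w) w, overshoot X V (crossing_index X V w) w).
  move=> [n _ nw]; apply: (cylinders_ext cB) => u /=.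
  by rewrite in_itv/= andbT => u0; rewrite (crossing_indexE nw) (ZE n).
by apply/seteqP; split=> w [/[dup] Uw /E EB] /= BZ; split=> //; move: BZ; rewrite EB.
Qed.

End regenerative_paths.

Lemma path_law_timing (r b : R) B : 0 <= b -> cylinders `[0, +oo[ B ->
  path_law P (fun u => growing r X (b + u)) B =
  (\int[P]_w law_from r B (timing X b w))%E.
Proof.
move=> b0 cB.
(* The first crossing occurs in the gap containing [b], with the residual gap as excess. The maximum
   keeps [V n] nonnegative once the renewals have passed [b]. *)
pose V n w := Num.max 0 (b - renewal (gaps X w) n).
have V0 n w : 0 <= V n w by rewrite le_max lexx.
have Vb n w : V n w <= b.
  by rewrite ge_max b0 lerBlDr lerDl; exact: renewal_ge0.
have mV n : measurable_fun setT (V n : pastT X n -> R).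
  apply: measurable_maxr => //; apply: measurable_funB => //.
  by apply: measurable_sum => j; exact: measurable_past_variable.
have VE n w : crossing X V n w -> renewal (gaps X w) n <= b < renewal (gaps X w) n.+1.
  (* Without earlier crossings all renewals up to the [n]th are at most [b], so the maximum with 0
     is inactive. *)
  move=> [bw vw]; have rb k : (k <= n)%N -> renewal (gaps X w) k <= b.
    elim: k => [_|k IH kn]; first by rewrite renewal0.
    have := bw k kn; rewrite /V renewalS /gaps.
    by have := IH (ltnW kn); rewrite -subr_ge0 => /max_idPr ->; lra.
  rewrite rb//= renewalS; move: vw; rewrite /V.
  by have := rb n (leqnn n); rewrite -subr_ge0 => /max_idPr -> /=; rewrite /gaps; lra.
have VN n w : crossing X V n w -> V n w = b - renewal (gaps X w) n.
  by move=> /VE/andP[nb _]; rewrite /V; apply/max_idPr; rewrite subr_ge0.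
have as1 := crossing_as b0 Vb mV.
rewrite -[LHS]/(P [set w | B (fun u => r * timing X (b + u) w)]).
rewrite (regenerative_path_law b0 V0 Vb mV)//.
(* Off the null event without crossing, the crossed threshold is the age at time [b]. *)
- apply: ge0_ae_eq_integral => //.
  + exact: (measurableT_comp (measurable_law_from r cB) (measurable_crossing_threshold mV)).
  + exact: (measurableT_comp (measurable_law_from r cB) (measurable_timing b0)).
  + exists (~` \bigcup_n crossing X V n); split.
    * by apply: measurableC; exact: measurable_crossings.
    * by apply: (etrans (probability_setC P (measurable_crossings mV))); rewrite as1 subee.
    apply: subsetC => w [n _ nw] _ /=.
    rewrite (crossing_indexE nw) VN//; congr law_from.
    by rewrite -(age_between (X_gt0 w) (VE n w nw)).
- by move=> u u0; apply: measurable_timing; exact: addr_ge0.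
move=> n w u nw u0; rewrite VN// -[LHS]/(age (gaps X w) (b + u)).
rewrite (age_markov (X_gt0 w) (VE n w nw) u0) /overshoot VN// renewalS.
by congr (age_from _ (prepend _ _) _); rewrite /gaps; ring.
Qed.

(* [P] need not be complete, so the null event where no gap exceeds [a] matters:
   there [hitting_time X a] is finite if the renewal times accumulate, and is
   [inf set0 = 0] otherwise. *)
Lemma measurable_timing_from (a u : R) : 0 <= a -> 0 <= u ->
  measurable_fun setT (timing_from X a u).
Proof.
move=> a0 u0; pose V (n : nat) (w : T) := a.
have mV n : measurable_fun setT (V n : pastT X n -> R) by exact: measurable_cst.
pose U := \bigcup_n crossing X V n.
pose W := [set w | has_ubound (range (renewal (gaps X w)))].
have mU : measurable U by exact: measurable_crossings.
have mW : measurable W.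
  (* Integer bounds suffice, which keeps the operations countable. *)
  rewrite (_ : W = \bigcup_(m : nat) \bigcap_n [set w | renewal (gaps X w) n <= m%:R]).
    apply: bigcupT_measurable => m; apply: bigcapT_measurable => n.
    have mm : measurable_fun setT (cst m%:R : T -> R) by exact: measurable_cst.
    have := measurable_fun_ler (measurable_renewal n (measurable_gaps X)) mm.
    by move=> /(_ measurableT [set true] I); rewrite setTI.
  apply/seteqP; split=> w /=.
    move=> [M wM]; exists (Num.truncn M).+1 => // n _ /=.
    by rewrite (le_trans (wM _ _)) ?ltW ?truncnS_gt//; exists n.
  by move=> [m _ wm]; exists m%:R => _ [n _ <-]; exact: wm.
rewrite (_ : timing_from X a u = fun w =>
  if w \in U then age_from a (overshoot X V (crossing_index X V w) w) u
  else if w \in W then a + u else timing X u w); last first.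
  apply/funext => w; rewrite -[LHS]/(age (gaps X w) (hitting (gaps X w) a + u)).
  case: ifPn => [|/negP]; rewrite inE.
    move=> [n _ /[dup] nw [bw vw]]; rewrite (crossing_indexE nw).
    exact: age_hitting_crossing.
  move=> /(no_crossing (fun _ _ => lexx a)) wa; case: ifPn => [|/negP]; rewrite inE => Ww.
    exact: age_hitting_bounded.
  exact: age_hitting_unbounded.
have mb (S : set T) : measurable S -> measurable_fun setT (fun w => w \in S).
  move=> mS; apply: (measurable_fun_bool true); rewrite setTI.
  by rewrite (_ : _ @^-1` _ = S)//; apply/seteqP; split=> w /=; [exact: set_mem|exact: mem_set].
apply: measurable_fun_ifT; [exact: mb| |apply: measurable_fun_ifT => //].
- have ma : measurable_fun setT (cst a : T -> R) by exact: measurable_cst.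
  have := measurable_fun_pair ma (measurable_overshoot mV).
  exact: (measurableT_comp (measurable_age_from u0)).
- exact: mb.
- exact: measurable_timing.
Qed.

(* A negative level is never hit, so that its hitting time is [inf set0 = 0]. *)
Lemma path_law_growing_from (r a : R) B : 0 < r -> cylinders `[0, +oo[ B ->
  path_law P (growing_from r X a) B = law_from r B (Num.max 0 (a / r)).
Proof.
move=> r0 cB; have [a0|a0] := leP 0 a; last first.
  have ar0 : a / r < 0 by rewrite pmulr_llt0// invr_gt0.
  rewrite max_l ?ltW// /law_from /path_law; congr (P _); apply/funext => w /=.
  congr B; apply/funext => u; rewrite /growing_from /age_from if_same addr0.
  by congr (r * _); exact: age_hitting_neg.
have ar0 : 0 <= a / r by rewrite divr_ge0// ltW.
rewrite max_r// -[LHS]/(P [set w | B (fun u => r * timing_from X (a / r) u w)]).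
pose V (n : nat) (w : T) := a / r.
have mV n : measurable_fun setT (V n : pastT X n -> R) by exact: measurable_cst.
rewrite (regenerative_path_law ar0 (fun _ _ => ar0) (fun _ _ => lexx _) mV)//.
- by rewrite /V integral_probability_cst.
- by move=> u u0; exact: measurable_timing_from.
by move=> n w u [bw vw] u0; exact: age_hitting_crossing.
Qed.

(** The age at [t] is at least [x] exactly when the residual gap at time [t - x] exceeds [x], and
    that residual gap is distributed as a gap. *)
Lemma timing_tail (t x : R) : 0 <= x <= t ->
  P [set w | x <= timing X t w] = P [set w | x < X 0%N w].
Proof.
move=> /andP[x0 xt]; have tx : 0 <= t - x by rewrite subr_ge0.
pose B := [set f : R -> R | x <= f x].
have cB : cylinders `[0, +oo[ B.
  rewrite (_ : B = [set f | `[x, +oo[%classic (f x)]).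
    by apply: cylinders_coord => //=; rewrite in_itv/= x0.
  by apply/seteqP; split=> f /=; rewrite in_itv/= andbT.
rewrite [LHS](_ : _ = path_law P (fun u => growing 1 X (t - x + u)) B); last first.
  by congr (P _); apply/funext => w; rewrite /B /growing /= subrK mul1r.
rewrite path_law_timing//.
(* Whether the age reaches [x] after a delay [x] does not depend on the initial age, so the
   integrand is constant. *)
rewrite (eq_integral (cst (P [set w | (x < X 0%N w)%R]))).
  exact: integral_probability_cst.
move=> w _; congr (P _); apply/seteqP; split=> w' /=; rewrite /age_paths /B /age_from /= mul1r.
  case: ltP => // Xx; rewrite addr0 => xa.
  have := @age_le _ (gaps X w') x 1%N; rewrite renewalS renewal0 add0r => /(_ Xx).
  by have := X_gt0 w' 0%N; lra.
move=> xX; rewrite /gaps xX (age_before_first (X_gt0 w')) ?x0//.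
by rewrite lerDl; exact: (@age_ge0 _ (gaps X w) _ tx).
Qed.

(** Truncation leaves only the tails at levels [c <= l]; for positive [c], [timing_tail] applies
    since [c / r <= l / r <= t], and its value does not involve [t]. *)
Lemma law_truncated_growing (r l t t' : R) (C : set R) : 0 < r -> 0 <= l ->
  l / r <= t -> l / r <= t' -> measurable C ->
  P [set w | C (Num.min (growing r X t w) l)] =
  P [set w | C (Num.min (growing r X t' w) l)].
Proof.
move=> r0 l0 lt lt' mC; have lr0 : 0 <= l / r by rewrite divr_ge0// ltW.
have mm s : l / r <= s -> measurable_fun setT (fun w => Num.min (growing r X s w) l).
  move=> ls; apply: measurable_minr => //; apply: measurable_funM => //.
  by apply: measurable_timing; exact: le_trans ls.
pose G := [set A : set R | A = setT \/ exists c, A = `[c, +oo[%classic].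
have GC : <<s G >> C.
  have : (@ocitv R).-sigma.-measurable C by exact: mC.
  rewrite RGenCInfty.measurableE.
  apply: sub_smallest2r; first exact: smallest_sigma_algebra.
  by move=> A [c ->]; right; exists c.
have := @factorization_unique _ _ _ P _ _ _ _ (mm t lt) (mm t' lt') setT G
  measurableT _ _ _ _ C GC.
rewrite setTI probability_setT mul1e; apply.
- move=> A B [->|[a ->]] [->|[b ->]]; rewrite ?setTI ?setIT; first by left.
  + by right; exists b.
  + by right; exists a.
  + right; exists (Num.max a b); apply/seteqP; split=> x /=.
      by rewrite !in_itv/= !andbT ge_max => -[-> ->].
    by rewrite !in_itv/= !andbT ge_max => /andP[].
- by left.
- by move=> A [->|[a ->]].
move=> B [->|[c ->]]; first by rewrite !preimage_setT setTI probability_setT mule1.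
rewrite setTI mul1e.
have tail s : l / r <= s -> P ((fun w => Num.min (growing r X s w) l) @^-1` `[c, +oo[%classic)
   = if l < c then 0%E else if c <= 0 then 1%E else P [set w | c / r < X 0%N w].
  move=> ls; have s0 : 0 <= s by exact: le_trans ls.
  case: ltP => [lc|cl].
    rewrite (_ : _ @^-1` _ = set0) ?measure0//; apply/seteqP; split=> // w /=.
    by rewrite in_itv/= andbT le_min => /andP[_]; rewrite leNgt lc.
  case: leP => [c0|c0].
    rewrite (_ : _ @^-1` _ = setT) ?probability_setT//; apply/seteqP; split=> // w _ /=.
    rewrite in_itv/= andbT le_min cl andbT (le_trans c0)//.
    by rewrite mulr_ge0 ?(ltW r0)//; exact: (@age_ge0 _ (gaps X w) _ s0).
  rewrite -(@timing_tail s); last first.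
    apply/andP; split; first by rewrite divr_ge0//; exact: ltW.
    by apply: le_trans ls; rewrite ler_pM2r// invr_gt0.
  congr (P _); apply/seteqP; split=> w /=; rewrite in_itv/= andbT le_min cl andbT.
    by rewrite ler_pdivrMr// mulrC.
  by rewrite ler_pdivrMr// mulrC.
by rewrite !tail.
Qed.

End timing_law.

(** * Haircuts *)

Section haircuts.
Context {R : realType} d (T : measurableType d) (P : probability T R).
Context (lambda r : R) (X : nat -> {RV P >-> R}).
Hypotheses (lambda_gt0 : 0 < lambda) (r_gt0 : 0 < r)
  (X_iid : iid_exponential lambda X).

Lemma integral_same_law (f f' : T -> R) (g : R -> \bar R) :
  measurable_fun setT f -> measurable_fun setT f' -> measurable_fun setT g ->
  (forall a, (0 <= g a)%E) ->
  (forall C, measurable C -> P [set w | C (f w)] = P [set w | C (f' w)]) ->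
  (\int[P]_w g (f w) = \int[P]_w g (f' w))%E.
Proof.
move=> mf mf' mg g0 ff'.
pose F : {RV P >-> R} := HB.pack f (isMeasurableFun.Build _ _ _ _ _ mf).
pose F' : {RV P >-> R} := HB.pack f' (isMeasurableFun.Build _ _ _ _ _ mf').
have := ge0_integral_distribution F mg g0.
have := ge0_integral_distribution F' mg g0.
move=> <- <-; apply: eq_measure_integral => C mC _; exact: ff'.
Qed.

(** The haircut integrates the kernel against the law of [min (G s, l)]. Replacing it by the law of
    the growing process at [b] gives the Markov property at [b]. *)
Lemma law_after_haircut (l s b : R) (G G' : R -> T -> R) B :
  0 <= s -> 0 <= b -> measurable_fun setT (G s) -> acts r X (l, s) G G' ->
  (forall C, measurable C -> P [set w | C (Num.min (G s w) l)] =
     P [set w | C (growing r X b w)]) ->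
  cylinders `[0, +oo[ B ->
  P [set w | B (fun u => G' (s + u) w)] =
  path_law P (fun u => growing r X (b + u)) B.
Proof.
move=> s0 b0 mG [_ haircut] Gb cB.
(* Taking the whole space for [A] removes the conditioning on the past. *)
rewrite (path_law_timing lambda_gt0 X_iid)// -[X in P X]setTI haircut//; last first.
  by have [? GC ?] := smallest_sigma_algebra setT
    (\bigcup_(t in `[0, s]) preimage_set_system setT (G t) measurable);
    rewrite -(setD0 setT); exact: GC.
have mmax : measurable_fun setT (fun a : R => Num.max 0 (a / r)).
  by apply: measurable_maxr => //; exact: measurable_funM.
under eq_integral do rewrite (path_law_growing_from lambda_gt0 X_iid _ r_gt0 cB).
have mb : measurable_fun setT (growing r X b).
  by apply: measurable_funM => //; exact: measurable_timing.
rewrite (integral_same_law (g := fun a => law_from X r B (Num.max 0 (a / r))) _ mb)//.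
(* Dividing the length by [r] recovers the age, which is nonnegative, so the maximum with 0 is
   harmless. *)
- apply: eq_integral => w _; congr law_from.
  rewrite /growing mulrAC divff ?gt_eqF// mul1r; apply/max_idPr.
  exact: (@age_ge0 _ (gaps X w) _ b0).
- exact: measurable_minr.
- exact: (measurableT_comp (measurable_law_from X r cB) mmax).
Qed.

End haircuts.

(** * Induction over the haircuts *)

Theorem theorem25 (R : realType) (d : measure_display) (T : measurableType d)
    (P : probability T R) (lambda r : R) (X : nat -> {RV P >-> R})
    (lambda_gt0 : 0 < lambda) (r_gt0 : 0 < r)
    (X_iid : iid_exponential lambda X)
    (l s i : R) (l_ge0 : 0 <= l) (s_ge0 : 0 <= s) (l_le_rs : l <= r * s)
    (i_gt0 : 0 < i) (H : R -> T -> R)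
    (H_haircut : haircut_process r X (fun k => (l, s + k%:R * i)) H)
    (n : nat) (n_gt0 : (0 < n)%N) :
  eq_law P P `[0, i[ (fun u => H (s + n%:R * i + u))
    (fun u => growing r X (l / r + u)).
Proof.
have [Hs [mHs Hs0 Hacts Hlim]] := H_haircut.
have b0 : 0 <= l / r by rewrite divr_ge0// ltW.
have s_ge k : 0 <= s + k%:R * i by rewrite addr_ge0// mulr_ge0// ltW.
(* The age at time [l / r] is at most [l / r], so truncating the length at [l] has no effect
   there. *)
have growing_le w : growing r X (l / r) w <= l.
  rewrite /growing mulrC -ler_pdivlMr//; exact: (@age_le_time _ (gaps X w) _ b0).
have truncated t C : l / r <= t -> measurable C ->
    P [set w | C (Num.min (growing r X t w) l)] = P [set w | C (growing r X (l / r) w)].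
  move=> bt mC.
  rewrite (law_truncated_growing lambda_gt0 X_iid r_gt0 l_ge0 bt (lexx _) mC).
  by congr (P _); apply/funext => w /=; rewrite min_l.
have after k : (forall C, measurable C ->
      P [set w | C (Num.min (Hs k (s + k%:R * i) w) l)] =
      P [set w | C (growing r X (l / r) w)]) -> forall B, cylinders `[0, +oo[ B ->
    P [set w | B (fun u => Hs k.+1 (s + k%:R * i + u) w)] =
    path_law P (fun u => growing r X (l / r + u)) B.
  move=> IH B cB; apply: (law_after_haircut lambda_gt0 r_gt0 X_iid _ _ _ (Hacts k)) => //.
  exact: mHs.
have at_haircut k C : measurable C ->
    P [set w | C (Num.min (Hs k (s + k%:R * i) w) l)] =
    P [set w | C (growing r X (l / r) w)].
  elim: k C => [|k IH] C mC.
    rewrite mul0r addr0 Hs0// truncated//.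
    by rewrite ler_pdivrMr// mulrC.
  (* This event reads the path after one period, that is, just before the next haircut acts; the
     comparison time [l / r + i] is again at least [l / r]. *)
  pose B := [set f : R -> R | C (Num.min (f i) l)].
  have cB : cylinders `[0, +oo[ B.
    have mC' : measurable [set a | C (Num.min a l)].
      have mm : measurable_fun setT (fun a : R => Num.min a l) by exact: measurable_minr.
      by have := mm measurableT _ mC; rewrite setTI.
    by apply: (cylinders_coord _ mC'); rewrite /= in_itv/= ltW.
  have := after k IH B cB; rewrite /B /path_law /= truncated//; last by rewrite lerDl ltW.
  by rewrite -addrA -[in X in _ + (_ + X)](mul1r i) -mulrDl natr1.
(* Haircuts are counted from 0, so [Hs n.+1] is the process once the haircut at time [s + n%:R * i]
   has acted. *)
move=> B cB; rewrite -(after n (at_haircut n)); last first.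
  apply: cylinders_subset cB => u /=; rewrite !in_itv/= andbT.
  by move=> /andP[].
congr (P _); apply/funext => w /=; apply: (cylinders_ext cB) => u /=.
rewrite in_itv/= => /andP[u0 ui]; set t := s + n%:R * i + u.
have t0 : 0 <= t by rewrite addr_ge0.
(* All further haircuts occur at [s + n.+1%:R * i] or later, hence after [t]. *)
have stable m : Hs (n.+1 + m)%N t = Hs n.+1 t.
  elim: m => [|m IH]; first by rewrite addn0.
  have [frozen _] := Hacts (n.+1 + m)%N.
  rewrite addnS frozen// t0/= /t -addrA ltrD2l (lt_le_trans (y := n.+1%:R * i))//.
    by rewrite -natr1 mulrDl mul1r ltrD2l.
  by rewrite ler_pM2r// ler_nat leq_addr.
have [K _ HK] := Hlim t t0.
rewrite (HK (n.+1 + K)%N) /=; first by rewrite stable.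
by rewrite leq_addl.
Qed.
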